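(* For all integers $t,n\ge 2$ we have $R_{cr}(t,n)=2t(n-1)+1$.
   Context: The ordered complete graph on $[m]=\{1,\dots,m\}$ is the complete graph with vertex set $[m]$, taken with its natural ordering; edges are written $(i,j)$ with $i<j$. Two edges are independent if they share no vertex; independent edges $(a,b)$ and $(c,d)$ are crossing if $a<c<b<d$ or $c<a<d<b$. A matching is a set of pairwise independent edges; it is crossing if any two of its edges are crossing, and monochromatic if all its edges have the same color. $R_{cr}(t,n)$ denotes the smallest $m$ such that in every coloring of the edges of the ordered complete graph on $[m]$ with $t$ colors there is a monochromatic crossing matching with $n$ edges. *)

(* Defs.v *)
From mathcomp Require Import all_boot.

Set Implicit Arguments.
Unset Strict Implicit.
Unset Printing Implicit Defensive.

(* The vertex set [m] is represented by 'I_m = {0, ..., m - 1}; only the order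
   of the vertices matters, so the shift by one is harmless. *)
Definition edge (m : nat) := {e : 'I_m * 'I_m | e.1 < e.2}.

Definition ledge (m : nat) (e : edge m) : 'I_m := (val e).1.
Definition redge (m : nat) (e : edge m) : 'I_m := (val e).2.

Definition independent (m : nat) (e f : edge m) : bool :=
  [&& ledge e != ledge f, ledge e != redge f,
      redge e != ledge f & redge e != redge f].

Definition crossing (m : nat) (e f : edge m) : bool :=
  independent e f &&
  ([&& ledge e < ledge f, ledge f < redge e & redge e < redge f]
   || [&& ledge f < ledge e, ledge e < redge f & redge f < redge e]).

Definition matching (m : nat) (M : {set edge m}) : bool :=
  [forall e in M, forall f in M, (e != f) ==> independent e f].

Definition crossing_matching (m : nat) (M : {set edge m}) : bool :=
  matching M && [forall e in M, forall f in M, (e != f) ==> crossing e f].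

Definition monochromatic (t m : nat) (col : {ffun edge m -> 'I_t})
    (M : {set edge m}) : bool :=
  [forall e in M, forall f in M, col e == col f].

Definition cr_ramsey (t n m : nat) : bool :=
  [forall col : {ffun edge m -> 'I_t}, exists M : {set edge m},
    [&& crossing_matching M, monochromatic col M & #|M| == n]].

(* Pigeonhole on the pairwise crossing edges (i, N + i), i < N, of the complete
   graph on 2N vertices, with N = t * n + 1. *)
Lemma cr_ramsey_exists (t n : nat) : exists m : nat, cr_ramsey t n m.
Proof.
pose N := (t * n).+1; exists (N + N); apply/forallP => col.
have lt_e (i : 'I_N) : (lshift N i, rshift N i).1 < (lshift N i, rshift N i).2.
  by rewrite /= (leq_trans (ltn_ord i)) // leq_addr.
pose E i : edge (N + N) := exist _ (lshift N i, rshift N i) (lt_e i).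
have E_inj : injective E.
  by move=> i j /(congr1 (@ledge _)); rewrite /ledge /= => /lshift_inj.
have [k le_nk] : exists k : 'I_t, n <= #|[set i | col (E i) == k]|.
  apply/existsP; apply: contraT; rewrite negb_exists => /forallP lt_n.
  have: N <= t * n.
    rewrite -[in leqLHS](card_ord N) -sum1_card.
    rewrite (partition_big (fun i => col (E i)) predT) //=.
    rewrite -[t in t * n]card_ord -sum_nat_const.
    apply: leq_sum => k _; rewrite sum1_card.
    have := lt_n k; rewrite -ltnNge => /ltnW; apply: leq_trans.
    by apply/subset_leq_card/subsetP => i; rewrite inE.
  by rewrite ltnn.
have [A sA cA] : exists2 A : {set 'I_N},
    A \subset [set i | col (E i) == k] & #|A| = n.
  set B := [set i | _] in le_nk *.
  exists [set x in take n (enum B)].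
    by apply/subsetP => i; rewrite inE => /mem_take; rewrite mem_enum.
  rewrite cardsE (card_uniqP _) ?take_uniq ?enum_uniq //.
  by rewrite size_takel // -cardE.
have crE i j : E i != E j -> crossing (E i) (E j).
  rewrite (inj_eq E_inj) -val_eqE /= => ne_ij.
  rewrite /crossing /independent /ledge /redge /= -!val_eqE /=.
  have [hi hj] := (ltn_ord i, ltn_ord j).
  rewrite eqn_add2l ne_ij !ltn_add2l !(ltn_addr _ hi) !(ltn_addr _ hj) /=.
  rewrite (ltn_eqF (ltn_addr _ hi)) eq_sym (ltn_eqF (ltn_addr _ hj)) /=.
  by rewrite !andbb -neq_ltn.
apply/existsP; exists (E @: A); apply/and3P; split.
- apply/andP; split; apply/forall_inP => _ /imsetP[i _ ->];
    apply/forall_inP => _ /imsetP[j _ ->]; apply/implyP => /crE //.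
  by case/andP.
- apply/forall_inP => _ /imsetP[i /(subsetP sA) + ->].
  rewrite inE => /eqP->.
  apply/forall_inP => _ /imsetP[j /(subsetP sA) + ->].
  by rewrite inE eq_sym.
- by rewrite card_imset // cA.
Qed.

Definition R_cr (t n : nat) : nat := ex_minn (cr_ramsey_exists t n).

(* Main.v *)
(** Upper bound: on [2s+1] vertices, [s = t(n-1)], the edges joining almost
    opposite vertices are cyclically ordered so that two of them cross unless
    they are neighbours.  Some color contains [2n-1] of these [2s+1] edges, not
    all of them, and choosing every other one beyond a gap leaves [n] pairwise
    crossing edges.

    Lower bound: crossing edges [(a,b)], [(c,d)] with [a < c < b < d] satisfy
    [2 <= (c+d) - (a+b) <= m - 2].  Hence for [m <= 2t(n-1)] the halves of the
    residues of the vertex sums modulo [2t(n-1)] are distinct on a crossing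
    matching; coloring by blocks of [n-1] consecutive values of that half leaves
    at most [n-1] edges in each monochromatic crossing matching. *)

Require Import Defs.
From mathcomp Require Import all_boot zify.

Lemma crossing_sym m (e f : edge m) : crossing e f = crossing f e.
Proof.
rewrite /crossing /independent !(eq_sym (ledge f)) !(eq_sym (redge f)) orbC.
by congr (_ && _); case: (_ != _) => //=; rewrite andbCA.
Qed.

Definition half_sum q {m} (e : edge m) : nat := ((ledge e + redge e) %% q.*2)./2.

(** Equal halves would put both residues in one pair [{2h, 2h+1}], so [y - x] would lie within 1 of
    a multiple of [2q]; the hypotheses say [2 <= y - x <= 2q - 2]. *)
Lemma half_modn_neq q x y : x.+1 < y -> y.+1 < x + q.*2 ->
  (x %% q.*2)./2 != (y %% q.*2)./2.
Proof.
move=> lt_xy lt_yx; have q_gt0 : 0 < q.*2 by lia.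
have := ltn_pmod x q_gt0; have := ltn_pmod y q_gt0.
have := divn_eq x q.*2; have := divn_eq y q.*2.
move: (x %/ _) (y %/ _) (x %% _) (y %% _) => a b r r' Dy Dx lt_r' lt_r.
apply/eqP => eq_half.
have [le_ba | lt_ab] := leqP b a; nia.
Qed.

Lemma half_sum_crossing {q m} {e f : edge m} :
  m <= q.*2 -> crossing e f -> half_sum q e != half_sum q f.
Proof.
rewrite /crossing /half_sum => le_mq /andP[_].
have := ltn_ord (redge e); have := ltn_ord (redge f).
move: (nat_of_ord (ledge e)) (nat_of_ord (redge e)) => a b.
move: (nat_of_ord (ledge f)) (nat_of_ord (redge f)) => c d.
move=> lt_dm lt_bm /orP[]/and3P[lt1 lt2 lt3]; first by apply: half_modn_neq; lia.
by rewrite eq_sym; apply: half_modn_neq; lia.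
Qed.

Lemma not_cr_ramsey t k m :
  0 < t -> 0 < k -> m <= (t * k).*2 -> ~~ cr_ramsey t k.+1 m.
Proof.
move=> t_gt0 k_gt0 le_m; have tk_gt0 : 0 < (t * k).*2 by rewrite double_gt0 muln_gt0 t_gt0.
have lt_col (e : edge m) : half_sum (t * k) e %/ k < t.
  by rewrite ltn_divLR // ltn_half_double ltn_pmod.
rewrite negb_forall; apply/existsP.
exists [ffun e => Ordinal (lt_col e)]; rewrite negb_exists; apply/forallP => M.
apply/negP => /and3P[/andP[_ crM] /forall_inP monoM /eqP cardM].
(* The color is the quotient of [half_sum] by [k], so inside one color class the remainder
   determines [half_sum], and there are only [k] remainders. *)
pose r (e : edge m) : 'I_k := Ordinal (ltn_pmod (half_sum (t * k) e) k_gt0).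
have r_inj : {in M &, injective r}.
  move=> e f Me Mf /(congr1 val)/= eq_mod; apply/eqP/negP => /negP ne_ef.
  have /forall_inP/(_ f Mf)/implyP/(_ ne_ef) := forall_inP crM e Me.
  move/(half_sum_crossing le_m)/eqP; apply.
  have /forall_inP/(_ f Mf) := monoM e Me; rewrite !ffunE -val_eqE => /eqP/= eq_div.
  by rewrite (divn_eq (half_sum _ e) k) eq_div eq_mod -divn_eq.
have := leq_card_in _ _ r_inj.
by rewrite card_ord cardM ltnn.
Qed.

(** Keep [x], drop its successor [y] and recurse: every later [z] satisfies [z > y > x]. *)
Lemma every_other {s : seq nat} : sorted ltn s ->
  exists u, [/\ subseq u s, size u = uphalf (size s)
              & pairwise (fun i j => i.+1 < j) u].
Proof.
have [N] := ubnP (size s); elim: N s => // N IHN [|x [|y s]] /= lt_sN.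
- by exists [::].
- by exists [:: x]; rewrite /= eqxx.
case/andP=> lt_xy sorted_ys.
have [u [sub_us size_u far_u]] := IHN s (ltnW lt_sN) (path_sorted sorted_ys).
exists (x :: u); split=> /=.
  by rewrite eqxx; apply: subseq_trans sub_us (subseq_cons s y).
  by rewrite size_u.
rewrite far_u andbT; apply/allP => z /(mem_subseq sub_us).
by have /allP/[apply] := order_path_min ltn_trans sorted_ys; apply: leq_ltn_trans.
Qed.
 
(** For [i, j <= 2s]: distinct and non-adjacent on the cycle of length [2s+1], whose wrap-around
    adjacent pair is [{0, 2s}]. *)
Definition cyc_far s (i j : nat) : bool :=
  (i.+1 < j) && ((0 < i) || (j < s.*2)) || (j.+1 < i) && ((0 < j) || (i < s.*2)).

Lemma cyc_far_subset {s k} {P : pred nat} :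
  k < s -> k.*2 < count P (iota 0 s.*2.+1) ->
  exists u, [/\ all P u, all (fun i => i < s.*2.+1) u, size u = k.+1
              & pairwise (cyc_far s) u].
Proof.
move=> lt_ks count_P.
set m := s.*2.+1 in count_P *; pose Q i := P (i %% m).
have count_shift g : g <= m -> count Q (iota g m) = count P (iota 0 m).
  move=> le_gm; rewrite -{1}(subnK le_gm) -(subnKC le_gm) !iotaD !count_cat.
  rewrite subnKC // addnC add0n; congr (_ + _).
    rewrite subnKC // -[X in iota X]addn0 iotaDl count_map.
    by apply: eq_in_count => i; rewrite mem_iota /Q /= modnDl => lt_i; rewrite modn_small; lia.
  by apply: eq_in_count => i; rewrite mem_iota /Q => lt_i; rewrite modn_small; lia.
(* Cut the cycle at [g]. If some index fails [P], cutting there loses nothing; otherwise any cut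
   leaves [2s > 2k] indices. *)
have [g lt_gm count_g] : exists2 g, g < m & k.*2 < count Q (iota g.+1 s.*2).
  have [allP | ] := boolP (all P (iota 0 m)).
    exists 0 => //; have: count Q (iota 0 m) = m.
      by rewrite count_shift //; move: allP; rewrite all_count size_iota => /eqP.
    by rewrite /m /=; case: (Q 0); lia.
  case/allPn => g; rewrite mem_iota => lt_gm /negPf nPg; exists g => //.
  by move: count_P; rewrite -(count_shift g) ?(ltnW lt_gm) //= {1}/Q modn_small // nPg.
have [u [sub_u size_u far_u]] :=
  every_other (sorted_filter ltn_trans Q (iota_ltn_sorted g.+1 s.*2)).
have le_ku : k < size u by rewrite size_u size_filter; lia.
have /allP u_range : all (fun i => Q i && (g < i <= g + s.*2)) u.
  apply/allP => i /(mem_subseq sub_u); rewrite mem_filter mem_iota.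
  by case/andP=> -> /=; lia.
exists [seq i %% m | i <- take k.+1 u]; split.
- rewrite all_map; apply/allP => i /mem_take/u_range/andP[] //.
- by rewrite all_map; apply/allP => i _; rewrite /= ltn_pmod.
- by rewrite size_map size_takel.
rewrite pairwise_map; move: (subseq_pairwise (take_subseq u k.+1) far_u).
apply: (@sub_in_pairwise _ (mem u)); last by apply/allP => i /mem_take.
(* Both indices lie in a window of length [2s], so [2 <= j - i <= 2s - 1], which keeps them
   non-adjacent modulo [2s+1]. *)
move=> i j /u_range/andP[_ range_i] /u_range/andP[_ range_j] /= lt_ij.
have modE l : g < l <= g + s.*2 -> l %% m = if l < m then l else l - m.
  move=> range_l; case: ltnP => [|le_ml]; first exact: modn_small.
  by rewrite -{1}(subnK le_ml) modnDr modn_small; lia.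
by rewrite !modE // /cyc_far; case: (ltnP i m); case: (ltnP j m); lia.
Qed.

Lemma star_edge_lt {s} (s_gt0 : 0 < s) (i : 'I_s.*2.+1) :
  let e : 'I_s.*2.+1 * 'I_s.*2.+1 := (inord i./2, inord (s + uphalf i)) in
  e.1 < e.2.
Proof. by have lt_i := ltn_ord i; rewrite /= !inordK; lia. Qed.

(* Indexed in the cyclic order in which neighbouring edges share a vertex. *)
Definition star_edge {s} (s_gt0 : 0 < s) (i : 'I_s.*2.+1) : edge s.*2.+1 :=
  exist _ (inord i./2, inord (s + uphalf i)) (star_edge_lt s_gt0 i).

(** If [i + 2 <= j], both endpoints strictly increase from [i] to [j]; the left end of [j] stays
    below the right end of [i] except when [i = 0] and [j = 2s], where both equal [s]. *)
Lemma star_edge_crossing {s} (s_gt0 : 0 < s) (i j : 'I_s.*2.+1) :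
  cyc_far s i j -> crossing (star_edge s_gt0 i) (star_edge s_gt0 j).
Proof.
wlog lt_ij : i j / i < j.
  move=> IH far_ij; have [/IH->//|/IH far_ji|eq_ij] := ltngtP i j.
    by rewrite crossing_sym far_ji // /cyc_far orbC.
  by move: far_ij; rewrite /cyc_far eq_ij; lia.
have := ltn_ord i; have := ltn_ord j.
rewrite /cyc_far /crossing /independent /ledge /redge /= -!val_eqE /= => lt_j lt_i.
by rewrite !inordK; lia.
Qed.

(** The endpoints of edge [i] sum to [s + i]. *)
Lemma star_edge_inj {s} (s_gt0 : 0 < s) : injective (star_edge s_gt0).
Proof.
move=> i j eq_ij; apply: val_inj => /=; have := ltn_ord i; have := ltn_ord j.
have /(congr1 val) := congr1 (@ledge _) eq_ij.
have /(congr1 val) := congr1 (@redge _) eq_ij.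
by rewrite /ledge /redge /= => + + lt_j lt_i; rewrite !inordK; lia.
Qed.

Lemma pigeonhole_count {t : nat} (T : Type) (f : T -> 'I_t) (s : seq T) q :
  t * q < size s -> exists c, q < count (fun x => f x == c) s.
Proof.
move=> lt_tq; apply/existsP; apply: contraLR lt_tq.
rewrite negb_exists -leqNgt => /forallP le_q.
rewrite -sum1_size (partition_big f predT) //= -[t in t * q]card_ord -sum_nat_const.
by apply: leq_sum => c _; rewrite sum1_count leqNgt.
Qed.

Lemma cr_ramsey_star t k : 1 < t -> 0 < k -> cr_ramsey t k.+1 (t * k).*2.+1.
Proof.
move=> t_gt1 k_gt0; set s := t * k; apply/forallP => col.
(* Having two colors or more enters here. *)
have lt_ks : k < s by rewrite /s ltn_Pmull.
have s_gt0 : 0 < s := ltn_trans k_gt0 lt_ks.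
have [c count_c] : exists c, k.*2 <
    count (fun i => col (star_edge s_gt0 (inord i)) == c) (iota 0 s.*2.+1).
  by apply: pigeonhole_count; rewrite size_iota /s; nia.
have [u [/allP col_u /allP lt_u size_u far_u]] := cyc_far_subset lt_ks count_c.
have uniq_u : uniq u by apply: pairwise_uniq far_u => i; rewrite /cyc_far; lia.
pose E i : edge s.*2.+1 := star_edge s_gt0 (inord i).
have E_inj : {in u &, injective E}.
  by move=> i j /lt_u lt_i /lt_u lt_j /star_edge_inj/(congr1 val); rewrite /= !inordK.
(* [pairwise] only compares in list order; the symmetry of [cyc_far] covers the other order. *)
have far i j : i \in u -> j \in u -> i != j -> cyc_far s i j.
  move=> ui uj ne_ij; have /(pairwiseP 0) far_nth := far_u.
  rewrite -[i](nth_index 0 ui) -[j](nth_index 0 uj).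
  have [lt_ij|lt_ji|/(congr1 (nth 0 u))] := ltngtP (index i u) (index j u).
  - by apply: far_nth; rewrite ?inE ?index_mem.
  - by rewrite /cyc_far orbC; apply: far_nth; rewrite ?inE ?index_mem.
  - by rewrite !nth_index // => /eqP; rewrite (negPf ne_ij).
have crE i j : i \in u -> j \in u -> E i != E j -> crossing (E i) (E j).
  move=> ui uj ne_ij; apply: star_edge_crossing; rewrite !inordK ?lt_u //.
  by apply: far => //; apply: contraNneq ne_ij => ->.
have memE e : e \in [set e in map E u] -> exists2 i, i \in u & e = E i.
  by rewrite inE => /mapP.
apply/existsP; exists [set e in map E u]; apply/and3P; split.
- apply/andP; split; apply/forall_inP => _ /memE[i ui ->];
    apply/forall_inP => _ /memE[j uj ->]; apply/implyP => /crE cr_ij.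
  + by have /andP[] := cr_ij ui uj.
  + exact: cr_ij.
- apply/forall_inP => _ /memE[i ui ->]; apply/forall_inP => _ /memE[j uj ->].
  by rewrite (eqP (col_u i ui)) (eqP (col_u j uj)).
- by rewrite cardsE (card_uniqP _) ?map_inj_in_uniq // size_map size_u.
Qed.

Theorem theorem2p18 (t n : nat) (ht : 2 <= t) (hn : 2 <= n) :
  R_cr t n = 2 * t * (n - 1) + 1.
Proof.
case: n hn => // k k_gt0; rewrite /R_cr; case: ex_minnP => m ramsey_m min_m.
have -> : 2 * t * (k.+1 - 1) + 1 = (t * k).*2.+1 by rewrite subn1 addn1 -mulnA mul2n.
apply/eqP; rewrite eqn_leq min_m ?cr_ramsey_star //= ltnNge.
by apply: contraL ramsey_m; apply: not_cr_ramsey; lia.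
Qed.
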